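(* There exists a tree $T$ such that for every positive integer $k$, $\pi(T[E_k])=4k$.
   Context: $E_k$ is the empty (edgeless) graph on $k$ vertices. The lexicographic product $G[H]$ of graphs $G=(V_1,E_1)$ and $H=(V_2,E_2)$ has vertex set $V_1\times V_2$, and $(v_1,v_2)$ is joined to $(v_1',v_2')$ if either $(v_1,v_1')\in E_1$, or $v_1=v_1'$ and $(v_2,v_2')\in E_2$. A sequence $x_1\ldots x_{2l}$ ($l\ge 1$) is a repetition if $x_i=x_{l+i}$ for all $1\le i\le l$. A vertex coloring $c$ of a graph $G$ is nonrepetitive if there is no path $v_1,\ldots,v_{2l}$ in $G$ (with distinct vertices, $l\ge1$) such that $c(v_1),\ldots,c(v_{2l})$ is a repetition. The Thue chromatic number $\pi(G)$ is the least number of colors in a nonrepetitive coloring of $G$. *)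

(* Defs.v *)
From mathcomp Require Import all_boot.

Set Implicit Arguments.
Unset Strict Implicit.
Unset Printing Implicit Defensive.

(* Finite simple graphs. *)
Record sgraph := SGraph {
  svertex :> finType;
  sedge : rel svertex;
  sedge_sym : symmetric sedge;
  sedge_irrefl : irreflexive sedge }.

Lemma edgeless_sym k : symmetric (fun _ _ : 'I_k => false).
Proof. by []. Qed.

Lemma edgeless_irrefl k : irreflexive (fun _ _ : 'I_k => false).
Proof. by []. Qed.

Definition edgeless (k : nat) : sgraph :=
  SGraph (@edgeless_sym k) (@edgeless_irrefl k).

Definition lex_rel (G H : sgraph) : rel (G * H) :=
  fun u v => sedge u.1 v.1 || (u.1 == v.1) && sedge u.2 v.2.

Lemma lex_rel_sym (G H : sgraph) : symmetric (@lex_rel G H).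
Proof. by move=> u v; rewrite /lex_rel !(sedge_sym v.1, sedge_sym v.2) eq_sym. Qed.

Lemma lex_rel_irrefl (G H : sgraph) : irreflexive (@lex_rel G H).
Proof. by move=> u; rewrite /lex_rel !sedge_irrefl andbF. Qed.

Definition lexprod (G H : sgraph) : sgraph :=
  SGraph (@lex_rel_sym G H) (@lex_rel_irrefl G H).

Definition connected_graph (G : sgraph) : Prop :=
  0 < #|G| /\ forall x y : G, connect (@sedge G) x y.

(* [ucycle] also holds of [:: x; y] for any edge xy; hence [2 < size s]. *)
Definition acyclic_graph (G : sgraph) : Prop :=
  forall s : seq G, 2 < size s -> ~ ucycle (@sedge G) s.

Definition is_tree (G : sgraph) : Prop :=
  connected_graph G /\ acyclic_graph G.

Definition simple_path (G : sgraph) (s : seq G) : bool :=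
  sorted (@sedge G) s && uniq s.

Definition repetition (C : eqType) (s : seq C) : bool :=
  [&& 0 < size s, ~~ odd (size s)
    & take (size s)./2 s == drop (size s)./2 s].

Definition nonrepetitive (G : sgraph) (C : eqType) (c : G -> C) : Prop :=
  forall s : seq G, simple_path s -> ~~ repetition (map c s).

(* Boolean version: a simple path has at most #|G| vertices. *)
Definition nonrepetitiveb (G : sgraph) (C : eqType) (c : G -> C) : bool :=
  [forall n : 'I_#|G|.+1, forall s : n.-tuple G,
     simple_path s ==> ~~ repetition (map c s)].

Lemma nonrepetitiveP (G : sgraph) (C : eqType) (c : G -> C) :
  reflect (nonrepetitive c) (nonrepetitiveb c).
Proof.
apply: (iffP forallP) => [h s sP | h n]; last first.
  by apply/forallP=> s; apply/implyP=> /h.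
have lt_s : size s < #|G|.+1.
  by case/andP: sP => _ us; rewrite ltnS -(card_uniqP us) max_card.
by have /forallP/(_ (in_tuple s))/implyP/(_ sP) := h (Ordinal lt_s).
Qed.

Definition nonrep_colorable (G : sgraph) (m : nat) : bool :=
  [exists c : {ffun G -> 'I_m}, nonrepetitiveb c].

Lemma nonrep_colorableP (G : sgraph) (m : nat) :
  reflect (exists c : G -> 'I_m, nonrepetitive c) (nonrep_colorable G m).
Proof.
apply: (iffP existsP) => [[c /nonrepetitiveP cP] | [c cP]]; first by exists c.
exists [ffun x => c x]; apply/nonrepetitiveP => s /cP.
by rewrite (eq_map (ffunE c)).
Qed.

Lemma nonrep_colorable_ex (G : sgraph) : exists m, nonrep_colorable G m.
Proof.
exists #|G|; apply/nonrep_colorableP; exists enum_rank => s /andP[_ us].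
rewrite /repetition -map_take -map_drop; apply/negP => /and3P[s_gt0 s_even].
rewrite (inj_eq (inj_map enum_rank_inj)) !size_map in s_gt0 s_even *.
set h := (size s)./2 => /eqP eq_h.
have h_gt0 : 0 < h by rewrite /h; case: (s) s_gt0 s_even => [|x [|]].
have : uniq (take h s ++ drop h s) by rewrite cat_take_drop.
have : 0 < size (take h s).
  by rewrite size_take_min leq_min h_gt0; case: (s) s_gt0.
by rewrite -eq_h cat_uniq; case: (take h s) => //= x t _; rewrite mem_head andbF.
Qed.

Definition thue_number (G : sgraph) : nat := ex_minn (nonrep_colorable_ex G).

Lemma thue_numberP (G : sgraph) (m : nat) :
  (exists c : G -> 'I_m, nonrepetitive c) <-> thue_number G <= m.
Proof.
rewrite /thue_number; case: ex_minnP => n /nonrep_colorableP[c cP] n_min.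
split=> [/nonrep_colorableP/n_min // | le_nm].
have widen_inj : injective (widen_ord le_nm).
  by move=> i j eq_ij; apply/val_inj/(congr1 val eq_ij).
exists (widen_ord le_nm \o c) => s /cP; apply: contraNN.
rewrite map_comp /repetition !size_map -[take _ (map _ _)]map_take -map_drop.
by rewrite (inj_eq (inj_map widen_inj)).
Qed.

(* Main.v *)
Require Import Defs.
From mathcomp Require Import all_boot zify.

(** The tree is the complete 4-ary tree of height 6, whatever the value of k.

A path of T[E_k] projects to a walk of T that may visit a vertex up to k
times, so a colouring of T must be lifted with care.  Colour (v, i) by the
pair (depth of v mod 4, i).  Along a walk the depth changes by 1 or -1, and
these differ modulo 4; hence in a repetition the two halves of the walk have
the same depths up to a constant, and since all depths lie in {0, ..., 6}
that constant is 0 (depth_period).  Let m be the least depth on the walk.  The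
walk never leaves the subtree below one vertex of depth m, so each time it
reaches depth m it is at that vertex (walk_same_vertex).  The two halves thus
meet T at the same vertex at some common position; the second components of
the colours agree there too, so the path repeats a vertex of T[E_k]: this is
absurd.  Hence 4k colours suffice (depth_coloring_nonrepetitive).

Conversely, suppose that fewer than 4k colours are used.  Write S(v) for the
set of colours on the copy of E_k above v.  If v_1, ..., v_2l is a path of T
with S(v_i) meeting S(v_(l+i)) for all i <= l, then it lifts to a repetition
(no_meeting_path).
 - Four neighbours of v carry more than #|C| vertices, so two of these have
   the same colour; a repetition of length 4 then forces the k colours above
   v to be distinct (palette_rainbow).  So |S(v)| = k for every inner v, and
   four such sets are never pairwise disjoint (forced_meet).
 - The root r is disjoint from its children (in terms of S), so two of its
   children, u and u', meet; the path u, r, u', w shows that r is disjoint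
   from every child w of u'.  Any two children of u' then meet, because r, u'
   and these children are four sets, and the argument can be repeated one
   level lower (avoids_grandchildren_step).
 - This yields a descending path v_0, ..., v_5 in which vertices at distance
   1 or 2 have disjoint colour sets.  Among v_i, ..., v_(i+3) only the two
   ends can meet, so they do: v_0 meets v_3, v_1 meets v_4 and v_2 meets v_5,
   a repetition of length 6 (full_tree_lower). *)

Set Implicit Arguments.
Unset Strict Implicit.
Unset Printing Implicit Defensive.

Lemma thue_number_le_card (G : sgraph) (C : finType) (c : G -> C) :
  nonrepetitive c -> thue_number G <= #|C|.
Proof.
move=> cP; apply/thue_numberP; exists (enum_rank \o c) => s /cP.
apply: contraNN; rewrite map_comp /repetition !size_map.
by rewrite -[take _ (map _ _)]map_take -map_drop (inj_eq (inj_map enum_rank_inj)).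
Qed.

(** * Complete trees *)

(** A vertex is the word of the choices made on the way down from the root, so
    the ancestor of x at depth m is [take m x]. *)
Definition is_parent d h : rel (h.-bseq 'I_d) :=
  fun x y => prefix x y && (size y == (size x).+1).

Definition tree_rel d h : rel (h.-bseq 'I_d) :=
  fun x y => is_parent x y || is_parent y x.

Lemma tree_rel_sym d h : symmetric (@tree_rel d h).
Proof. by move=> x y; rewrite /tree_rel orbC. Qed.

Lemma tree_rel_irrefl d h : irreflexive (@tree_rel d h).
Proof. by move=> x; rewrite /tree_rel /is_parent; lia. Qed.

Definition full_tree d h : sgraph := SGraph (@tree_rel_sym d h) (@tree_rel_irrefl d h).

Lemma tree_rel_size d h (x y : h.-bseq 'I_d) :
  tree_rel x y -> size y = (size x).+1 \/ size x = (size y).+1.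
Proof. by case/orP => /andP[_ /eqP]; [left | right]. Qed.

(** A walk that stays at depth at least m keeps the same ancestor at depth m. *)
Lemma tree_rel_take d h (x y : h.-bseq 'I_d) m :
  tree_rel x y -> m <= size x -> m <= size y -> take m x = take m y :> seq _.
Proof.
by case/orP=> /andP[/prefixP[w ->] _] lex ley; rewrite takel_cat.
Qed.

Lemma tree_rel_parent d h (x y : h.-bseq 'I_d) :
  tree_rel x y -> size y <= size x -> y = take (size x).-1 x :> seq _.
Proof.
move=> /orP[/andP[_ /eqP->]|/andP[/prefixP[w ->] /eqP->]]; first by rewrite ltnn.
by rewrite take_size_cat.
Qed.

Lemma full_tree_connected d h : connected_graph (full_tree d h).
Proof.
split; first by apply/card_gt0P; exists ([bseq] : h.-bseq 'I_d).
pose r : full_tree d h := ([bseq] : h.-bseq 'I_d).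
have from_root n (x : h.-bseq 'I_d) :
    size x = n -> connect (@sedge (full_tree d h)) r x.
  elim: n x => [|n IHn] x sz_x.
    have -> : x = [bseq] by apply/val_inj/size0nil.
    exact: connect0.
  pose p : h.-bseq 'I_d := [bseq of take n x].
  have sz_p : size p = n by rewrite size_takel // sz_x.
  apply: (connect_trans (IHn p sz_p)); apply/connect1/orP; left.
  by rewrite /is_parent prefix_take sz_p sz_x /=.
move=> x y; apply: (connect_trans _ (from_root _ y erefl)).
rewrite sym_connect_sym; last exact: sedge_sym.
exact: from_root.
Qed.

(** On a cycle, both neighbours of a deepest vertex are its parent. *)
Lemma full_tree_acyclic d h : acyclic_graph (full_tree d h).
Proof.
move=> s; case def_s: s => [//|x0 s']; rewrite -def_s => s_gt2.
have x0s : x0 \in s by rewrite def_s mem_head.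
case/andP=> cyc_s uniq_s.
have [x xs max_x] :
    exists2 x : h.-bseq 'I_d, x \in s &
      forall y : h.-bseq 'I_d, y \in s -> size y <= size x.
  by case: (@arg_maxnP (h.-bseq 'I_d) x0 (mem s) size x0s) => x; exists x.
have [i t def_rot] := rot_to xs.
have cyc_t : cycle (@tree_rel d h) (x :: t) by rewrite -def_rot rot_cycle.
have uniq_t : uniq (x :: t) by rewrite -def_rot rot_uniq.
have sz_t : 1 < size t by move: s_gt2; rewrite -(size_rot i) def_rot.
have max_t y : y \in t -> size y <= size x.
  by move=> yt; apply: max_x; rewrite -(mem_rot i) def_rot in_cons yt orbT.
case/lastP: t sz_t cyc_t uniq_t max_t {def_rot} => [//|[//|y t] z] _.
rewrite /= rcons_path last_rcons => /and3P[xy _ zx].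
move=> /and3P[_ + _] max_t; rewrite mem_rcons in_cons.
case/norP=> /eqP[]; apply/val_inj => /=.
rewrite (tree_rel_parent xy) ?max_t ?mem_head //.
rewrite tree_rel_sym in zx; rewrite (tree_rel_parent zx) //.
by rewrite max_t // in_cons mem_rcons mem_head orbT.
Qed.

Lemma full_tree_is_tree d h : is_tree (full_tree d h).
Proof. by split; [apply: full_tree_connected | apply: full_tree_acyclic]. Qed.

(** * Four k colours suffice *)

Definition depth_coloring d h k
    (u : lexprod (full_tree d h) (edgeless k)) : 'I_4 * 'I_k :=
  (inord (size (u.1 : h.-bseq 'I_d) %% 4), u.2).

Lemma depth_coloring_eq d h k (u v : lexprod (full_tree d h) (edgeless k)) :
  depth_coloring u = depth_coloring v ->
  size (u.1 : h.-bseq 'I_d) = size (v.1 : h.-bseq 'I_d) %[mod 4] /\ u.2 = v.2.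
Proof.
case=> /(congr1 val); rewrite /= !inordK ?ltn_pmod //.
Qed.

(** Steps of 1 and -1 differ modulo 4, so both halves have the same steps and
    [D (l + j) - D j] is a constant e divisible by 4.  If e = 4, then
    [D l.-1 >= D 0 + 3] and so [D (l + l.-1) >= D 0 + 7], which exceeds 6; the
    case e = -4 is symmetric.  The bound is sharp: 0, 1, ..., 7 has l = 4. *)
Lemma depth_period (D : nat -> nat) l : 0 < l ->
  (forall j, j.+1 < l + l -> D j.+1 = (D j).+1 \/ D j = (D j.+1).+1) ->
  (forall j, j < l + l -> D j <= 6) ->
  (forall j, j < l -> D j = D (l + j) %[mod 4]) ->
  forall j, j < l -> D (l + j) = D j.
Proof.
move=> l_gt0 stepD leD6 eqD4.
have shift j : j < l -> D (l + j) + D 0 = D l + D j.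
  elim: j => [|j IHj] lt_j; first by rewrite addn0.
  have := IHj (ltnW lt_j); have := eqD4 j (ltnW lt_j); have := eqD4 j.+1 lt_j.
  have := stepD j ltac:(lia); have := stepD (l + j) ltac:(lia).
  rewrite addnS; lia.
have eq_Dl : D l = D 0.
  have l1 : l.-1.+1 = l by lia.
  have := shift l.-1 ltac:(lia); have := eqD4 0 l_gt0.
  have := stepD l.-1 ltac:(lia); have := leD6 0 ltac:(lia).
  have := leD6 (l + l.-1) ltac:(lia).
  rewrite l1 addn0; lia.
by move=> j lt_j; have := shift j lt_j; lia.
Qed.

(** The depths are periodic, so their minimum m over the first half is also the
    minimum over the whole walk.  All vertices of depth m on the walk are then
    the common ancestor at that depth. *)
Lemma walk_same_vertex d h (V : nat -> h.-bseq 'I_d) l : 0 < l ->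
  (forall j, j.+1 < l + l -> tree_rel (V j) (V j.+1)) ->
  (forall j, j < l -> size (V (l + j)) = size (V j)) ->
  exists2 j, j < l & V (l + j) = V j.
Proof.
move=> l_gt0 edgeV perV.
have [j _ min_j] := @arg_minnP _ (Ordinal l_gt0) predT (fun j => size (V j)) isT.
exists j => //; set m := size (V j) in min_j.
have ge_m i : i < l + l -> m <= size (V i).
  move=> lt_i; have [lt_il|le_li] := ltnP i l; first exact: (min_j (Ordinal lt_il)).
  have lt_i' : i - l < l by lia.
  by rewrite -(subnKC le_li) perV //; apply: (min_j (Ordinal lt_i')).
have anc i : i < l + l -> take m (V i) = take m (V 0) :> seq _.
  elim: i => // i IHi lt_i; rewrite -IHi; last exact: ltnW.
  by apply/esym/tree_rel_take; rewrite ?edgeV ?ge_m // ltnW.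
have lt_j := ltn_ord j.
apply/val_inj; rewrite /= -[LHS]take_size -[RHS]take_size perV // -/m.
by rewrite !anc //; lia.
Qed.

Lemma depth_coloring_nonrepetitive d h k :
  h <= 6 -> nonrepetitive (@depth_coloring d h k).
Proof.
move=> h_le6 s; case: (posnP (size s)) => [/size0nil -> //|].
case def_s: s => [//|u0 s'] _; rewrite -def_s.
case/andP=> /(sortedP u0) edge_s uniq_s; apply/negP => /and3P[].
rewrite size_map => s_gt0 /negbTE s_even /eqP rep_s.
set l := (size s)./2 in rep_s.
have sz_s : size s = l + l by rewrite addnn -[LHS]odd_double_half s_even.
have l_gt0 : 0 < l by lia.
have eq_col j : j < l ->
    depth_coloring (nth u0 s j) = depth_coloring (nth u0 s (l + j)).
  move=> lt_j; have := congr1 (fun t => nth (depth_coloring u0) t j) rep_s.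
  by rewrite nth_take // nth_drop !(nth_map u0) //; lia.
pose V j : h.-bseq 'I_d := (nth u0 s j).1.
have edgeV j : j.+1 < l + l -> tree_rel (V j) (V j.+1).
  by rewrite -sz_s => /edge_s; rewrite /= /lex_rel /= andbF orbF.
have perV : forall j, j < l -> size (V (l + j)) = size (V j).
  apply: (depth_period (D := fun j => size (V j))) => // j lt_j.
  - exact/tree_rel_size/edgeV.
  - exact: leq_trans (size_bseq _) h_le6.
  - by have [] := depth_coloring_eq (eq_col j lt_j).
have [j lt_j eqV] := walk_same_vertex l_gt0 edgeV perV.
have lt_lj : l + j < size s by rewrite sz_s ltn_add2l.
have := nth_uniq u0 lt_lj (leq_ltn_trans (leq_addl l j) lt_lj) uniq_s.
have [_ eq2] := depth_coloring_eq (eq_col j lt_j).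
rewrite [nth _ _ _]surjective_pairing -/(V _) eqV -eq2 -surjective_pairing eqxx.
lia.
Qed.

(** * Colour sets *)

Definition palette (G : sgraph) k (C : finType)
    (c : lexprod G (edgeless k) -> C) (x : G) : {set C} :=
  [set c (x, i) | i : 'I_k].

Definition meet (G : sgraph) k (C : finType)
    (c : lexprod G (edgeless k) -> C) : rel G :=
  fun x y => ~~ [disjoint palette c x & palette c y].

Lemma meetP (G : sgraph) k (C : finType)
    (c : lexprod G (edgeless k) -> C) (x y : G) :
  reflect (exists i j, c (x, i) = c (y, j)) (meet c x y).
Proof.
apply: (iffP pred0Pn) => [[a /andP[/imsetP[i _ ->] /imsetP[j _]]]|[i [j eq_ij]]].
  by exists i, j.
by exists (c (x, i)); rewrite /= {2}eq_ij !imset_f.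
Qed.

Lemma meet_lift (G : sgraph) k (C : finType)
    (c : lexprod G (edgeless k) -> C) (s t : seq G) :
  all2 (meet c) s t ->
  exists s' t', [/\ map fst s' = s, map fst t' = t & map c s' = map c t'].
Proof.
elim: s t => [|x s IHs] [|y t] //=; first by exists [::], [::].
case/andP=> /meetP[i [j eq_ij]] /IHs[s' [t' [<- <- eq_c]]].
by exists ((x, i) :: s'), ((y, j) :: t'); rewrite /= eq_c eq_ij.
Qed.

(** Repetitions in a lexicographic product come from paths of the base graph:
    an edge of G joins all vertices above its ends, so a common colour of the
    palettes can be chosen independently at each position. *)
Lemma no_meeting_path (G : sgraph) k (C : finType)
    (c : lexprod G (edgeless k) -> C) (s t : seq G) :
  nonrepetitive c -> 0 < size s ->
  simple_path (s ++ t) -> ~~ all2 (meet c) s t.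
Proof.
move=> cP s_gt0 /andP[edge_st uniq_st]; apply/negP.
case/meet_lift=> s' [t' [def_s def_t eq_c]].
have /cP/negP[] : simple_path (s' ++ t' : seq (lexprod G (edgeless k))).
  move: edge_st uniq_st; rewrite -def_s -def_t -map_cat /simple_path.
  rewrite sorted_map => edge_st /map_uniq ->; rewrite andbT.
  by apply: sub_sorted edge_st => u v uv; rewrite /= /lex_rel [sedge _ _]uv.
rewrite /repetition map_cat -eq_c size_cat size_map addnn odd_double doubleK.
rewrite take_size_cat ?size_map // drop_size_cat ?size_map // eqxx !andbT.
by rewrite double_gt0 -(size_map fst) def_s.
Qed.

Lemma sum_card_disjoint (T : finType) (s : seq {set T}) :
  pairwise (fun A B : {set T} => [disjoint A & B]) s ->
  \sum_(A <- s) #|A| <= #|T|.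
Proof.
move=> dis_s; suff -> : \sum_(A <- s) #|A| = #|\bigcup_(A <- s) A|.
  exact: max_card.
elim: s dis_s => [|A s IHs] /=; first by rewrite !big_nil cards0.
case/andP=> /allP disA /IHs; rewrite !big_cons => ->; apply/esym/eqP.
rewrite (leq_card_setU A _) big_seq.
elim/big_rec: _ => [|B D /disA dAB dAD]; first by rewrite -setI_eq0 setI0.
by rewrite -setI_eq0 setIUr setU_eq0 !setI_eq0 dAB.
Qed.

Lemma exists_meet (G : sgraph) k (C : finType)
    (c : lexprod G (edgeless k) -> C) (s : seq G) :
  #|C| < size s * k -> {in s, forall x, #|palette c x| = k} ->
  ~~ pairwise (fun x y => ~~ meet c x y) s.
Proof.
move=> ltC card_s; apply: contraL ltC => dis_s; rewrite -leqNgt.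
have := @sum_card_disjoint C (map (palette c) s).
rewrite big_map (eq_big_seq (fun=> k)) //= big_const_seq count_predT iter_addn_0.
rewrite pairwise_map mulnC => -> //.
by apply: sub_pairwise dis_s => x y /negbNE.
Qed.

(** The vertices above the neighbours of x outnumber the colours, so two of them
    have a common colour.  If two vertices above x also did, then alternating
    between the two pairs would give a repetition of length 4. *)
Lemma palette_rainbow (G : sgraph) k (C : finType)
    (c : lexprod G (edgeless k) -> C) d (x : G) (y : 'I_d -> G) :
  nonrepetitive c -> #|C| < d * k -> injective y ->
  (forall a, sedge x (y a)) -> #|palette c x| = k.
Proof.
move=> cP ltC inj_y edge_xy.
suff inj_c : injective (fun i => c (x, i)).
  by rewrite (card_imset _ inj_c) card_ord.
move=> i j eq_ij; apply/eqP/negPn/negP => ne_ij.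
have /injectivePn[[a i'] [[b j'] ne_ab eq_ab]] :
    ~~ injectiveb (fun u : 'I_d * 'I_k => c (y u.1, u.2)).
  apply/negP => /injectiveP/leq_card; rewrite card_prod !card_ord; lia.
pose s : seq (lexprod G (edgeless k)) :=
  [:: (y a, i'); (x, i); (y b, j'); (x, j)].
have /cP : simple_path s.
  rewrite /simple_path /= /lex_rel /= !inE !xpair_eqE !eqxx /=.
  rewrite !(sedge_sym (y _)) !edge_xy /= (negbTE ne_ij).
  have neq_xy e : (x == y e) = false.
    by apply: contraTF (edge_xy e) => /eqP <-; rewrite sedge_irrefl.
  rewrite !(eq_sym (y _) x) !neq_xy (inj_eq inj_y) /= !orbF !andbT.
  by rewrite -xpair_eqE.
by rewrite /repetition /= eq_ab eq_ij eqxx.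
Qed.

Lemma meet_sym (G : sgraph) k (C : finType)
    (c : lexprod G (edgeless k) -> C) : symmetric (meet c).
Proof. by move=> x y; rewrite /meet disjoint_sym. Qed.

Lemma edge_not_meet (G : sgraph) k (C : finType)
    (c : lexprod G (edgeless k) -> C) (x y : G) :
  nonrepetitive c -> sedge x y -> ~~ meet c x y.
Proof.
move=> cP xy; have := @no_meeting_path _ _ _ c [:: x] [:: y] cP isT.
rewrite /simple_path /= xy inE !andbT; apply.
by apply: contraTneq xy => ->; rewrite sedge_irrefl.
Qed.

Lemma forced_meet (G : sgraph) k (C : finType)
    (c : lexprod G (edgeless k) -> C) (w x y z : G) :
  #|C| < 4 * k -> {in [:: w; x; y; z], forall v, #|palette c v| = k} ->
  ~~ meet c w x -> ~~ meet c w y -> ~~ meet c x y ->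
  ~~ meet c x z -> ~~ meet c y z -> meet c w z.
Proof.
move=> ltC cards wx wy xy xz yz.
by have := exists_meet (s := [:: w; x; y; z]) ltC cards;
  rewrite /= wx wy xy xz yz /= !andbT negbK.
Qed.

(** * Fewer than four k colours do not suffice *)

(** For x at the bottom level, where there is no room for a child, the value is
    the root. *)
Definition child d h (x : h.-bseq 'I_d) (a : 'I_d) : h.-bseq 'I_d :=
  insub_bseq h (rcons x a).

Lemma childE d h (x : h.-bseq 'I_d) a :
  size x < h -> child x a = rcons x a :> seq _.
Proof. by move=> lt_xh; rewrite /child val_insubd size_rcons lt_xh. Qed.

Lemma size_child d h (x : h.-bseq 'I_d) a :
  size x < h -> size (child x a) = (size x).+1.
Proof. by move=> lt_xh; rewrite childE // size_rcons. Qed.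

Lemma child_inj d h (x : h.-bseq 'I_d) : size x < h -> injective (child x).
Proof.
move=> lt_xh a b /(congr1 val); rewrite /= !childE // => /rcons_inj[].
exact.
Qed.

Lemma child_parent d h (x : h.-bseq 'I_d) a :
  size x < h -> is_parent x (child x a).
Proof.
by move=> lt_xh; rewrite /is_parent size_child // childE // prefix_rcons eqxx.
Qed.

Lemma parent_edge d h (x y : h.-bseq 'I_d) : is_parent x y -> tree_rel x y.
Proof. by rewrite /tree_rel => ->. Qed.

Lemma parent_size d h (x y : h.-bseq 'I_d) : is_parent x y -> size y = (size x).+1.
Proof. by case/andP=> _ /eqP. Qed.

Lemma neq_size d h (x y : h.-bseq 'I_d) : size x != size y -> x != y.
Proof. by apply: contra_neq => ->. Qed.

Lemma inner_rainbow d h k (C : finType)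
    (c : lexprod (full_tree d h) (edgeless k) -> C) (x : h.-bseq 'I_d) :
  nonrepetitive c -> #|C| < d * k -> size x < h -> #|palette c x| = k.
Proof.
move=> cP ltC lt_xh; apply: (palette_rainbow cP ltC (child_inj lt_xh)) => a.
exact/parent_edge/child_parent.
Qed.

Lemma parent_not_meet d h k (C : finType)
    (c : lexprod (full_tree d h) (edgeless k) -> C) (x y : h.-bseq 'I_d) :
  nonrepetitive c -> is_parent x y -> ~~ meet c x y.
Proof. by move=> cP /parent_edge xy; apply: (edge_not_meet cP xy). Qed.

Definition avoids_grandchildren d h k (C : finType)
    (c : lexprod (full_tree d h) (edgeless k) -> C) (x y : h.-bseq 'I_d) :=
  forall z, is_parent y z -> ~~ meet c x z.

(** Otherwise y1, x, y2, z would be a path whose two halves meet. *)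
Lemma meeting_siblings d h k (C : finType)
    (c : lexprod (full_tree d h) (edgeless k) -> C) (x y1 y2 : h.-bseq 'I_d) :
  nonrepetitive c -> is_parent x y1 -> is_parent x y2 -> y1 != y2 ->
  meet c y1 y2 -> avoids_grandchildren c x y2.
Proof.
move=> cP xy1 xy2 ne_y12 meet_y12 z y2z.
have := @no_meeting_path _ _ _ c [:: y1; x] [:: y2; z] cP isT.
rewrite /= meet_y12 andbT; apply; rewrite /simple_path /=.
have y1x : tree_rel y1 x by rewrite tree_rel_sym; apply: parent_edge.
rewrite y1x (parent_edge xy2) (parent_edge y2z) /= !inE (negbTE ne_y12) /=.
have [s1 s2 s3] := And3 (parent_size xy1) (parent_size xy2) (parent_size y2z).
rewrite !negb_or; do !(apply/andP; split=> //); apply: neq_size; lia.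
Qed.

(** The palettes of x, y and of two children of y can only meet in the two
    children, and four palettes do not fit disjointly; so these siblings meet. *)
Lemma avoids_grandchildren_step h k (C : finType)
    (c : lexprod (full_tree 4 h) (edgeless k) -> C) (x y : h.-bseq 'I_4) :
  nonrepetitive c -> #|C| < 4 * k -> is_parent x y -> (size y).+1 < h ->
  avoids_grandchildren c x y -> avoids_grandchildren c y (child y ord_max).
Proof.
move=> cP ltC xy lt_yh avoid_xy; have lt_yh' := ltnW lt_yh.
pose z1 := child y ord0; pose z2 := child y ord_max.
have yz1 : is_parent y z1 by apply: child_parent.
have yz2 : is_parent y z2 by apply: child_parent.
apply: (@meeting_siblings _ _ _ _ _ _ z1) => //.
  by rewrite (inj_eq (child_inj lt_yh')).
have sz_xy := parent_size xy.
apply: (@forced_meet (full_tree 4 h) _ _ _ _ x y) => //.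
- move=> v; rewrite !inE => /or4P[] /eqP ->; apply: inner_rainbow => //;
  rewrite ?size_child //; lia.
- by rewrite meet_sym avoid_xy.
- by rewrite meet_sym parent_not_meet.
- exact: parent_not_meet.
- exact: avoid_xy.
- exact: parent_not_meet.
Qed.

(** With r, three children of r make four palettes; as r meets none of its
    children, two of the children meet.  This starts the descent. *)
Lemma root_avoids_grandchildren h k (C : finType)
    (c : lexprod (full_tree 4 h) (edgeless k) -> C) (r : h.-bseq 'I_4) :
  nonrepetitive c -> #|C| < 4 * k -> (size r).+1 < h ->
  exists2 y, is_parent r y & avoids_grandchildren c r y.
Proof.
move=> cP ltC lt_rh; have lt_rh' := ltnW lt_rh.
have par a := child_parent a lt_rh'.
suff [a [b ne_ab meet_ab]] : exists a, exists2 b, a != b &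
    meet c (child r a) (child r b).
  exists (child r b) => //; apply: (meeting_siblings cP (par a)) => //.
  by rewrite (inj_eq (child_inj lt_rh')).
pose y i := child r (inord i : 'I_4).
have neq i j : i < j < 4 -> (inord i : 'I_4) != inord j.
  by move=> lt_ij; rewrite -val_eqE /= !inordK; lia.
(* If child 0 meets neither child 1 nor child 2, then these two must meet. *)
have [m01|n01] := boolP (meet c (y 0) (y 1)).
  by exists (inord 0), (inord 1); rewrite ?neq.
have [m02|n02] := boolP (meet c (y 0) (y 2)).
  by exists (inord 0), (inord 2); rewrite ?neq.
exists (inord 1), (inord 2); rewrite ?neq //.
apply: (@forced_meet (full_tree 4 h) _ _ _ _ r (y 0)) => //.
- move=> v; rewrite !inE => /or4P[] /eqP ->; apply: inner_rainbow => //;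
  by rewrite size_child.
- by rewrite meet_sym parent_not_meet ?par.
- by rewrite meet_sym.
- exact: parent_not_meet (par _).
- exact: parent_not_meet (par _).
Qed.

Lemma full_tree_lower k (C : finType)
    (c : lexprod (full_tree 4 6) (edgeless k) -> C) :
  nonrepetitive c -> 4 * k <= #|C|.
Proof.
move=> cP; rewrite leqNgt; apply/negP => ltC.
pose v0 : 6.-bseq 'I_4 := [bseq].
have [v1 p01 a01] := root_avoids_grandchildren cP ltC (isT : (size v0).+1 < 6).
have s1 : size v1 = 1 := parent_size p01.
pose next (v : 6.-bseq 'I_4) := child v ord_max.
have grow u v : is_parent u v -> avoids_grandchildren c u v -> size v < 5 ->
    [/\ is_parent v (next v), avoids_grandchildren c v (next v)
      & ~~ meet c u (next v)].
  move=> uv avoid lt_v5; have v_next : is_parent v (next v).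
    by apply: child_parent; apply: ltnW.
  by split=> //; [apply: avoids_grandchildren_step avoid | apply: avoid].
set v2 := next v1; set v3 := next v2; set v4 := next v3; set v5 := next v4.
have [p12 a12 n02] := grow v0 v1 p01 a01 ltac:(by rewrite s1).
have s2 : size v2 = 2 by rewrite (parent_size p12) s1.
have [p23 a23 n13] := grow v1 v2 p12 a12 ltac:(by rewrite s2).
have s3 : size v3 = 3 by rewrite (parent_size p23) s2.
have [p34 a34 n24] := grow v2 v3 p23 a23 ltac:(by rewrite s3).
have s4 : size v4 = 4 by rewrite (parent_size p34) s3.
have [p45 _ n35] := grow v3 v4 p34 a34 ltac:(by rewrite s4).
have s5 : size v5 = 5 by rewrite (parent_size p45) s4.
have rainbow (v : 6.-bseq 'I_4) : size v < 6 -> #|palette c v| = k.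
  exact: inner_rainbow.
(* All bounds needed are met at height 6: the last vertex v5 of the descending
   path lies at depth 5, hence is inner. *)
have meet3 (w x y z : 6.-bseq 'I_4) : is_parent w x -> is_parent x y ->
    is_parent y z -> size z < 6 -> ~~ meet c w y -> ~~ meet c x z -> meet c w z.
  move=> wx xy yz lt_z wy xz.
  have lt_y : size y < 6 by rewrite ltnW // -(parent_size yz).
  have lt_x : size x < 6 by rewrite ltnW // -(parent_size xy).
  have lt_w : size w < 6 by rewrite ltnW // -(parent_size wx).
  apply: (@forced_meet (full_tree 4 6) _ _ _ _ x y) => //.
  - by move=> v; rewrite !inE => /or4P[] /eqP ->; apply: rainbow.
  - exact: parent_not_meet wx.
  - exact: parent_not_meet xy.
  - exact: parent_not_meet yz.
have m03 : meet c v0 v3 by apply: (meet3 v0 v1 v2 v3); rewrite ?s3.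
have m14 : meet c v1 v4 by apply: (meet3 v1 v2 v3 v4); rewrite ?s4.
have m25 : meet c v2 v5 by apply: (meet3 v2 v3 v4 v5); rewrite ?s5.
have := @no_meeting_path _ _ _ c [:: v0; v1; v2] [:: v3; v4; v5] cP isT.
rewrite /= m03 m14 m25 /= => no_path; apply/notF/no_path/andP; split.
  rewrite /= (parent_edge p01) (parent_edge p12) (parent_edge p23).
  by rewrite (parent_edge p34) (parent_edge p45).
apply: (@map_uniq _ _ (fun v : 6.-bseq 'I_4 => size v)).
by rewrite /= s5 s4 s3 s2 s1.
Qed.

Theorem lemma2p5 :
  exists T : sgraph, is_tree T /\
    forall k : nat, 0 < k -> thue_number (lexprod T (edgeless k)) = 4 * k.
Proof.
exists (full_tree 4 6); split; first exact: full_tree_is_tree.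
move=> k _; apply/eqP; rewrite eqn_leq; apply/andP; split.
  have := thue_number_le_card (@depth_coloring_nonrepetitive 4 6 k (leqnn 6)).
  by rewrite card_prod !card_ord.
have [c /full_tree_lower] :=
  (thue_numberP (lexprod (full_tree 4 6) (edgeless k)) _).2 (leqnn _).
by rewrite card_ord.
Qed.
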